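(* Let $X$ and $Y$ be Tychonoff spaces and let $\kappa$ be an infinite cardinal. If $C_p(X)$ and $C_p(Y)$ are uniformly homeomorphic, then $X$ is $\kappa$-pseudocompact if and only if $Y$ is $\kappa$-pseudocompact.
   Context: All spaces are Tychonoff (completely regular Hausdorff). $C_p(X)$ is the space of all continuous real-valued functions on $X$ with the topology of pointwise convergence. A map $\varphi:C_p(X)\to C_p(Y)$ is uniformly continuous if for each open neighborhood $U$ of the zero function in $C_p(Y)$ there is an open neighborhood $V$ of the zero function in $C_p(X)$ such that, for all $f,g\in C_p(X)$, $f-g\in V$ implies $\varphi(f)-\varphi(g)\in U$. $C_p(X)$ and $C_p(Y)$ are uniformly homeomorphic if there is a homeomorphism $\varphi$ between them such that both $\varphi$ and $\varphi^{-1}$ are uniformly continuous (linearity is not assumed). For an infinite cardinal $\kappa$, a space $X$ is $\kappa$-pseudocompact if for every continuous mapping $f:X\to\mathbb{R}^\kappa$ (product topology) the image $f(X)$ is compact. *)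

(* Defs.v *)
From HB Require Import structures.
From mathcomp Require Import all_boot all_order all_algebra.
From mathcomp Require Import all_classical all_reals all_analysis.

Set Implicit Arguments.
Unset Strict Implicit.
Unset Printing Implicit Defensive.

Import Order.TTheory GRing.Theory Num.Theory.
Import numFieldNormedType.Exports.

Local Open Scope classical_set_scope.
Local Open Scope ring_scope.

Definition tychonoff_space (X : topologicalType) : Prop :=
  completely_regular_space X /\ hausdorff_space X.

(* [continuousType X R] carries no canonical topology; [Cp R X] is this type
   with the topology induced by the product topology on [X -> R]. *)
Definition Cp (R : realType) (X : topologicalType) : Type :=
  continuousType X R.

Definition Cp_val (R : realType) (X : topologicalType)
  (f : continuousType X R) : {ptws X -> R} := f.

HB.instance Definition _ (R : realType) (X : topologicalType) :=
  Choice.on (Cp R X).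

HB.instance Definition _ (R : realType) (X : topologicalType) :=
  Topological.copy (Cp R X) (initial_topology (@Cp_val R X)).

Section Cp_zmodule.
Context {R : realType} {X : topologicalType}.
Implicit Types f g : Cp R X.

Let ctsD f g : continuous (fun x => (f : X -> R) x + (g : X -> R) x).
Proof. by move=> x; apply: cvgD; exact: cts_fun. Qed.

Let ctsN f : continuous (fun x => - (f : X -> R) x).
Proof. by move=> x; apply: cvgN; exact: cts_fun. Qed.

Let cts0 : continuous (fun _ : X => 0 : R).
Proof. by move=> x; exact: cvg_cst. Qed.

Definition Cp_add f g : Cp R X := mkcts (@ctsD f g).
Definition Cp_opp f : Cp R X := mkcts (@ctsN f).
Definition Cp_zero : Cp R X := mkcts cts0.

Let Cp_addA : associative Cp_add.
Proof. by move=> f g h; apply/continuousEP => x; exact: addrA. Qed.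

Let Cp_addC : commutative Cp_add.
Proof. by move=> f g; apply/continuousEP => x; exact: addrC. Qed.

Let Cp_add0 : left_id Cp_zero Cp_add.
Proof. by move=> f; apply/continuousEP => x; exact: add0r. Qed.

Let Cp_addN : left_inverse Cp_zero Cp_opp Cp_add.
Proof. by move=> f; apply/continuousEP => x; exact: addNr. Qed.

HB.instance Definition _ :=
  GRing.isZmodule.Build (Cp R X) Cp_addA Cp_addC Cp_add0 Cp_addN.

End Cp_zmodule.

Definition Cp_unif_continuous (R : realType) (X Y : topologicalType)
    (phi : Cp R X -> Cp R Y) : Prop :=
  forall U : set (Cp R Y), open_nbhs (0 : Cp R Y) U ->
  exists2 V : set (Cp R X), open_nbhs (0 : Cp R X) V &
    forall f g : Cp R X, V (f - g) -> U (phi f - phi g).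

Definition Cp_uniformly_homeomorphic (R : realType)
    (X Y : topologicalType) : Prop :=
  exists (phi : Cp R X -> Cp R Y) (psi : Cp R Y -> Cp R X),
    [/\ cancel phi psi, cancel psi phi,
        continuous phi /\ continuous psi,
        Cp_unif_continuous phi & Cp_unif_continuous psi].

(* The cardinal kappa is represented by a type [K] of that cardinality. *)
Definition kappa_pseudocompact (R : realType) (K : Type)
    (X : topologicalType) : Prop :=
  forall f : X -> {ptws K -> R}, continuous f -> compact (range f).

(* Main.v *)
Require Import Defs.
From mathcomp Require Import all_boot all_order all_algebra.
From mathcomp Require Import all_classical all_reals all_analysis.
From mathcomp Require Import lra.

(** The theorem holds because kappa-pseudocompactness is a statement about
    common zeros of families of continuous functions, and a uniformly continuous
    surjection between function spaces, evaluated at one point, only feels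
    finitely many points.

    Call a family (g_k), k in K, of continuous real functions approximately
    vanishing when for every finite sequence l in K some point x satisfies
    |g_{l_1} x| + ... + |g_{l_n} x| < 1. Entries of l may be repeated, so this
    says that finitely many g_k can be made simultaneously as small as desired.
    A space is kappa-pseudocompact exactly when every approximately vanishing
    family indexed by K has a common zero: closedness of the image of X in R^K is
    this property up to a translation, and boundedness of its coordinates follows
    by applying the property to 1 / (1 + |h|) ([kappa_pseudocompactP]). As K is
    infinite, K may be replaced by seq K * nat ([infinite_seq_nat_embeds]).

    Let phi : C_p(X) -> C_p(Y) and psi be uniformly continuous with phi o psi the
    identity, and assume the common zero property for X. By uniform continuity
    every y in Y has a finite support s in X: if |f - g| <= m on s then
    |phi f - phi g| <= (|s| + 1) (m + 1) at y ([exists_support]). Since functions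
    on X are bounded, C(Y) is a countable union of pointwise bounded sets, and
    this forces countable approximately vanishing families on Y to have common
    zeros ([sigma_bounded_common_zero], the idea of Uspenskii).

    Now let (g_k) be approximately vanishing on Y and let U_l be the set where the
    sum along l is < 1. By the countable case there is one n such that every U_l
    contains a point with a support of size n ([supports_of_bounded_size]). Choose
    an ultrafilter V containing, for every l, the set of these points of U_l, and
    let p_i(y) be the i-th point of the support of y, i < n. For some i the limit of p_i along V, thought of as an
    ideal point of X, feels every U_l: there are functions h vanishing off U_l
    that make |psi h - psi 0| arbitrarily large at p_i(y) for V-almost all y. For
    otherwise a large multiple of a bump function supported in a single U_l would
    contradict the support estimate at V-almost all y
    ([exists_essential_point]). The conditions |psi h - psi 0| >= N, over all l and
    N, are zero sets of an approximately vanishing family indexed by seq K * nat, so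
    some actual x in X satisfies all of them. A finite support t of x in Y for
    psi must then meet every U_l, and a finite set meeting every U_l contains a
    common zero of the g_k ([common_zero_property_transfer]). *)

Set Implicit Arguments.
Unset Strict Implicit.
Unset Printing Implicit Defensive.

Import Order.TTheory GRing.Theory Num.Theory.
Import numFieldNormedType.Exports.

Local Open Scope classical_set_scope.

(** * Finite sequences over an infinite set *)

(** Injectivity is required on [A] only, so that partial injections are plain
    functions and no subtypes are needed. *)
Definition embeds T U (A : set T) (B : set U) (f : T -> U) :=
  (forall a, A a -> B (f a)) /\
  (forall a b, A a -> A b -> f a = f b -> a = b).

Lemma embeds_comp T U V (A : set T) (B : set U) (C : set V)
    (f : T -> U) (g : U -> V) :
  embeds A B f -> embeds B C g -> embeds A C (g \o f).
Proof.
move=> [fAB finj] [gBC ginj]; split=> [a /fAB/gBC//|a b Aa Ab /= gfab].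
by apply: finj => //; apply: ginj => //; exact: fAB.
Qed.

(** A maximal partial injection between [A] and [B] has full domain or full range,
    since otherwise one more pair could be added to it. *)
Lemma comparable_sets T (A B : set T) :
  (exists f, embeds A B f) \/ (exists f, embeds B A f).
Proof.
pose partial_injection (G : set (T * T)) :=
  (forall p, G p -> A p.1 /\ B p.2) /\
  (forall p q, G p -> G q -> p.1 = q.1 <-> p.2 = q.2).
have [F Ftot FF|G [[GAB Ginj] Gmax]] := @Zorn_bigcup _ partial_injection.
  split=> [p [X /Ftot[XAB _] /XAB]//|p q [X FX Xp] [Y FY Yq]].
  have [/(_ _ Xp) Yp|/(_ _ Yq) Xq] := FF _ _ FX FY.
  - by have [_] := Ftot _ FY; exact.
  - by have [_] := Ftot _ FX; exact.
have [domG|/existsNP[a /not_implyP[Aa aG]]] :=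
    pselect (forall a, A a -> exists b, G (a, b)).
  have /choice[f fG] a : exists b, A a -> G (a, b).
    by have [/domG[b]|nA] := pselect (A a); [exists b|exists a].
  left; exists f; split=> [a Aa|x y Ax Ay fxy].
    by have [] := GAB _ (fG a Aa).
  by apply: (Ginj _ _ (fG x Ax) (fG y Ay)).2.
have ranG b : B b -> exists a, G (a, b).
  move=> Bb; apply: contrapT => bG.
  have sG : G `<` G `|` [set (a, b)].
    split=> [?|/(_ (a, b))]; first by left.
    by apply: contra_not aG => /(_ (or_intror erefl)) Gab; exists b.
  apply: (Gmax _ sG); split=> [p [/GAB//|->//]|p q [Gp|->] [Gq|->]//=].
  - exact: Ginj.
  - by split=> E; exfalso; [apply: aG; exists p.2|apply: bG; exists p.1];
      rewrite -E -surjective_pairing.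
  - by split=> E; exfalso; [apply: aG; exists q.2|apply: bG; exists q.1];
      rewrite E -surjective_pairing.
have /choice[f fG] b : exists a', B b -> G (a', b).
  by have [/ranG[a']|nB] := pselect (B b); [exists a'|exists b].
right; exists f; split=> [b Bb|x y Bx By fxy].
  by have [] := GAB _ (fG b Bb).
by apply: (Ginj _ _ (fG x Bx) (fG y By)).1.
Qed.

Section ListCodings.
Variable K : eqType.
Implicit Types (A B : set K) (s : seq K) (G : set (seq K * K)).

Definition lists A : set (seq K) := [set s | forall a, a \in s -> A a].

Lemma embeds_map A B f : embeds A B f -> embeds (lists A) (lists B) (map f).
Proof.
move=> [fAB finj]; split=> [s As _ /mapP[a sa ->]|]; first exact/fAB/As.
elim=> [|a s IHs] [|b t]//= As At [fab fst]; congr (_ :: _).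
  by apply: finj => //; [apply: As|apply: At]; rewrite mem_head.
by apply: IHs fst => c cs; [apply: As|apply: At]; rewrite inE cs orbT.
Qed.

(** A coding of lists is kept as a graph, the set on which it lives being read off
    the one-element lists: the union of a chain is then just the union of the
    graphs. *)
Definition coded G : set K := [set a | exists b, G ([:: a], b)].

Definition list_coding G :=
  [/\ forall p q, G p -> G q -> p.1 = q.1 <-> p.2 = q.2,
      forall p, G p -> lists (coded G) (p.2 :: p.1) &
      forall s, lists (coded G) s -> exists b, G (s, b)].

(** A list involves finitely many elements, so in a chain it is already a list over
    the elements coded by a single member. *)
Lemma list_coding_bigcup (F : set (set (seq K * K))) :
  F !=set0 -> F `<=` list_coding -> total_on F subset ->
  list_coding (\bigcup_(G in F) G).
Proof.
move=> [G0 FG0] Fcod Ftot; set U := \bigcup_(_ in _) _.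
have codedU G : F G -> coded G `<=` coded U.
  by move=> FG a [b Gab]; exists b, G.
split=> [p q [X FX Xp] [Y FY Yq]|p [X FX Xp] a pa|s Us].
- have [/(_ _ Xp) Yp|/(_ _ Yq) Xq] := Ftot _ _ FX FY.
  + by have [+ _ _] := Fcod _ FY; exact.
  + by have [+ _ _] := Fcod _ FX; exact.
- by have [_ + _] := Fcod _ FX => /(_ _ Xp a pa)/codedU; exact.
suff [G FG Gs] : exists2 G, F G & lists (coded G) s.
  by have [_ _ /(_ _ Gs)[b Gb]] := Fcod _ FG; exists b, G.
elim: s Us => [|a s IHs] Us; first by exists G0.
have [G FG Gs] : exists2 G, F G & lists (coded G) s.
  by apply: IHs => c cs; apply: Us; rewrite inE cs orbT.
have [b [H FH Hab]] := Us a (mem_head a s).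
have [GH|HG] := Ftot _ _ FG FH.
  exists H => // c; rewrite inE => /orP[/eqP->|/Gs[d Gcd]]; first by exists b.
  by exists d; exact: GH.
exists G => // c; rewrite inE => /orP[/eqP->|/Gs//].
by exists b; exact: HG.
Qed.

Lemma exists_maximal_list_coding G0 : list_coding G0 ->
  exists G, [/\ G0 `<=` G, list_coding G &
                forall H, G `<` H -> ~ list_coding H].
Proof.
move=> G0cod.
(* Adding G0 to every set keeps the empty chain from being an exception. *)
have [F Fcod Ftot|X [Xcod Xmax]] :=
    @Zorn_bigcup _ [set X | list_coding (G0 `|` X)].
  change (list_coding (G0 `|` \bigcup_(X in F) X)).
  have -> : G0 `|` \bigcup_(X in F) X =
      \bigcup_(H in [set G0 `|` X | X in F] `|` [set G0]) H.
    rewrite bigcup_setU bigcup_set1 bigcup_image; apply/seteqP; split=> p.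
      by case=> [|[X FX Xp]]; [right|left; exists X => //; right].
    by case=> [[X FX [|Xp]]|]; [left|right; exists X|left].
  apply: list_coding_bigcup; first by exists G0; right.
    by move=> _ [[X FX <-]|->//]; exact: Fcod.
  move=> _ _ [[X FX <-]|->] [[Y FY <-]|->].
  - by have [XY|YX] := Ftot _ _ FX FY; [left|right]; exact: setUS.
  - by right; exact: subsetUl.
  - by left; exact: subsetUl.
  - by left.
exists (G0 `|` X); split=> //.
move=> H [GH nHG] Hcod; apply: (Xmax H); last first.
  by rewrite /= (setUidPr _ _).2 //; apply: subset_trans GH => p; left.
split; first by apply: subset_trans GH; exact: subsetUr.
by move=> HX; apply: nHG => p /HX; right.
Qed.

Lemma list_coding_embeds G : list_coding G ->
  exists f, embeds (lists (coded G)) (coded G) f /\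
            forall s, lists (coded G) s -> G (s, f s).
Proof.
move=> [Ginj Gcod Gtot]; have [[k]|noK] := pselect (inhabited K); last first.
  have [b _] : exists b, G ([::], b) by apply: Gtot.
  by case: noK.
have /choice[f fG] s : exists b, lists (coded G) s -> G (s, b).
  by have [/Gtot[b]|] := pselect (lists (coded G) s); [exists b|exists k].
exists f; split=> //; split=> [s /fG/Gcod|s t Gs Gt fst].
  by apply; rewrite mem_head.
exact: (Ginj _ _ (fG s Gs) (fG t Gt)).2.
Qed.

(** An element of [A] is represented by a singleton, an element [a] of [B] outside
    [A] by the two-element list repeating its image [h a]; lists over the union thus
    become lists of lists over [A], which [f] codes twice. *)
Lemma embeds_union A B f h : embeds (lists A) A f -> embeds (B `\` A) A h ->
  exists g, embeds (lists (A `|` B)) A g.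
Proof.
move=> fA [hBA hinj].
pose code a := if `[< A a >] then [:: a] else [:: h a; h a].
have codeA : embeds (A `|` B) (lists A) code.
  split=> [a ABa b|a b ABa ABb]; rewrite /code.
    case: asboolP => [Aa|nAa]; rewrite !inE; first by move/eqP->.
    by rewrite orbb => /eqP->; apply: hBA; split=> //; case: ABa.
  case: asboolP => [Aa|nAa]; case: asboolP => [Ab|nAb]//= [] // hab.
  by apply: hinj => //; split=> //; [case: ABa|case: ABb].
exists (f \o map (f \o code)); apply: embeds_comp (fA); apply: embeds_map.
exact: embeds_comp fA.
Qed.

(** With a copy of [coded G] available in its complement, the lists over the union
    that are not yet coded are sent into the copy. *)
Lemma list_coding_extend G g : list_coding G -> coded G !=set0 ->
  embeds (coded G) (~` coded G) g -> exists2 H, G `<` H & list_coding H.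
Proof.
move=> Gcod [a0 Ga0] [gA ginj]; have [Ginj Gval Gtot] := Gcod.
set A := coded G in a0 Ga0 gA ginj *; pose B := g @` A.
have [f [fA fG]] := list_coding_embeds Gcod; rewrite -/A in fA fG.
have /choice[h hg] b : exists a, B b -> A a /\ g a = b.
  by have [[a Aa <-]|] := pselect (B b); [exists a|exists b].
have hBA : embeds (B `\` A) A h.
  split=> [b [/hg[]]//|b c [Bb _] [Bc _] hbc].
  by rewrite -(hg _ Bb).2 hbc (hg _ Bc).2.
have [c [cA cinj]] := embeds_union fA hBA.
have BA b : B b -> ~ A b by move=> [a Aa <-]; exact: gA.
pose new := [set p | [/\ lists (A `|` B) p.1, ~ lists A p.1 & p.2 = g (c p.1)]].
have newB p : new p -> B p.2 by move=> [/cA Acp _ ->]; exists (c p.1).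
pose H := G `|` new; exists H.
  split=> [p|/(_ ([:: g a0], g (c [:: g a0]))) HG]; first by left.
  have /BA : B (g a0) by exists a0.
  apply; apply: (Gval _ (HG _)) => /=; last by rewrite !inE eqxx orbT.
  right; split=> //= [b|/(_ (g a0))]; rewrite inE.
    by move=> /eqP->; right; exists a0.
  by rewrite eqxx => /(_ isT); exact: gA.
have codedH : coded H = A `|` B.
  apply/seteqP; split=> a.
    move=> [b [Gab|[/= + _ _]]]; first by left; exists b.
    by apply; rewrite inE.
  move=> [[b Gab]|Ba]; first by exists b; left.
  exists (g (c [:: a])); right; split=> //= [b|/(_ a)]; rewrite inE.
    by move=> /eqP->; right.
  by rewrite eqxx => /(_ isT); exact: BA.
rewrite /list_coding codedH; split=> [p q|p|s ABs].
- have GA r : G r -> lists A r.1 /\ A r.2.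
    move=> /Gval Gr; split=> [a ar|]; apply: Gr; first by rewrite inE ar orbT.
    by rewrite mem_head.
  move=> [Gp|np] [Gq|nq]; first exact: Ginj.
  + have [lp Ap] := GA _ Gp; have [_ nlq _] := nq; have := newB _ nq.
    by move=> /BA; split=> E; exfalso; [rewrite -E in nlq|rewrite E in Ap].
  + have [lq Aq] := GA _ Gq; have [_ nlp _] := np; have := newB _ np.
    by move=> /BA; split=> E; exfalso; [rewrite E in nlp|rewrite -E in Aq].
  + have [lp _ ->] := np; have [lq _ ->] := nq; split=> [->//|].
    by move=> /(ginj _ _ (cA _ lp) (cA _ lq))/cinj; exact.
- move=> [/Gval Gp a /Gp|np a]; first by left.
  by rewrite inE => /orP[/eqP->|]; [right; exact: newB|case: np => + _ _; exact].
- have [As|nAs] := pselect (lists A s); first by exists (f s); left; exact: fG.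
  by exists (g (c s)); right.
Qed.

Lemma list_coding_of_sequence (e : nat -> K) :
  injective e -> list_coding [set (map e s, e (pickle s)) | s in [set: seq nat]].
Proof.
move=> einj; set G := [set _ | _ in _].
have codedG a : coded G a <-> exists n, a = e n.
  split=> [[b [[|n []]// _ [<- _]]]|[n ->]]; first by exists n.
  by exists (e (pickle [:: n])), [:: n].
split=> [_ _ [s _ <-] [t _ <-]/=|_ [s _ <-] a /=|s Gs].
- split=> [/(inj_map einj)->//|/einj/(pcan_inj pickleK)->//].
- rewrite inE => /orP[/eqP->|/mapP[n _ ->]]; apply/codedG; first by exists (pickle s).
  by exists n.
- suff [t ->] : exists t, s = map e t by exists (e (pickle t)), t.
  elim: s Gs => [|a s IHs] Gs; first by exists [::].
  have [n ->] : exists n, a = e n by apply/codedG/Gs; rewrite mem_head.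
  have [t ->] : exists t, s = map e t.
    by apply: IHs => c cs; apply: Gs; rewrite inE cs orbT.
  by exists (n :: t).
Qed.

End ListCodings.

(** A list coding extending that of a countable subset and maximal among list
    codings lives on a set [A] which does not embed in its complement; the
    complement then embeds in [A], and so do the lists over the whole type. *)
Lemma infinite_seq_embeds (K : Type) :
  infinite_set [set: K] -> exists f : seq K -> K, injective f.
Proof.
elim/Ppointed: K => K; first by rewrite emptyE => /(_ (finite_set0 _)).
move=> /infiniteP/pcard_injP[e /in2TT einj].
have := list_coding_of_sequence einj.
set G0 := [set _ | _ in _] => /exists_maximal_list_coding.
move=> [G [G0G Gcod Gmax]].
have G0n : coded G !=set0.
  by exists (e 0), (e (pickle [:: 0])); apply: G0G; exists [:: 0].
have [f [fG _]] := list_coding_embeds Gcod.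
have [[g]|[h hG]] := comparable_sets (coded G) (~` coded G).
  by move=> /(list_coding_extend Gcod G0n)[H /Gmax].
rewrite -setTD in hG; have [c] := embeds_union fG hG.
by rewrite setUT => -[_ cinj]; exists c => s t; apply: cinj.
Qed.

Lemma infinite_seq_nat_embeds (K : Type) :
  infinite_set [set: K] -> exists f : seq K * nat -> K, injective f.
Proof.
move=> /infinite_seq_embeds[f finj].
(* A pair (s, n) is recovered from the list of lists made of s followed by n
   copies of s. *)
exists (fun p => f (map f (p.1 :: nseq p.2 p.1))) => -[s m] [t n] /finj.
move=> /(inj_map finj)/= [->] /(congr1 size).
by rewrite !size_nseq => ->.
Qed.

(** * Sums of absolute values and common zeros *)

Local Open Scope ring_scope.

Section AbsSum.
Context {R : realType} {X : Type} {K : Type}.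
Variable g : K -> X -> R.
Implicit Types (l : seq K) (x : X).

Definition abs_sum l x : R := \sum_(k <- l) `|g k x|.

Lemma abs_sum_ge0 l x : 0 <= abs_sum l x.
Proof. exact: sumr_ge0. Qed.

Lemma abs_sum_cat l1 l2 x :
  abs_sum (l1 ++ l2) x = abs_sum l1 x + abs_sum l2 x.
Proof. exact: big_cat. Qed.

Lemma abs_sum_nseq n k x : abs_sum (nseq n k) x = `|g k x| *+ n.
Proof. by rewrite /abs_sum big_nseq iter_addr_0. Qed.

Lemma abs_sum_flatten I (F : I -> seq K) (r : seq I) x :
  abs_sum (flatten [seq F i | i <- r]) x = \sum_(i <- r) abs_sum (F i) x.
Proof. by rewrite /abs_sum big_flatten big_map. Qed.

Lemma abs_sum_flatten_ge (I : eqType) (F : I -> seq K) (r : seq I) i x :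
  i \in r -> abs_sum (F i) x <= abs_sum (flatten [seq F i | i <- r]) x.
Proof.
move=> ir; rewrite abs_sum_flatten (big_rem i)//= lerDl.
by apply: sumr_ge0 => j _; exact: abs_sum_ge0.
Qed.

(** Repeating an index is how a condition [abs_sum l x < 1] expresses that a single
    value is small. *)
Lemma abs_sum_nseq_ge1 k x : g k x != 0 -> exists n, 1 <= abs_sum (nseq n k) x.
Proof.
move=> gk0; exists (Num.bound `|g k x|^-1).
rewrite abs_sum_nseq -mulr_natr -ler_pdivrMl ?normr_gt0// mulr1.
by apply/ltW/archi_boundP; rewrite invr_ge0.
Qed.

End AbsSum.

(** If no point of [t] were a common zero, each would violate the condition for some
    sequence of indices, and the concatenation of these would be violated on all
    of [t]. *)
Lemma common_zero_in_seq (R : realType) (X : eqType) K (g : K -> X -> R)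
    (t : seq X) :
  (forall l, exists2 x, x \in t & abs_sum g l x < 1) ->
  exists x, forall k, g k x = 0.
Proof.
move=> tP; apply: contrapT => noz.
have /choice[F F1] x : exists l, 1 <= abs_sum g l x.
  have /existsNP[k /eqP gkx] : ~ (forall k, g k x = 0).
    by move=> gx; apply: noz; exists x.
  by have [n gn] := abs_sum_nseq_ge1 gkx; exists (nseq n k).
have [x xt] := tP (flatten (map F t)).
by rewrite ltNge (le_trans (F1 x))// abs_sum_flatten_ge.
Qed.

Lemma continuous_abs_sum (R : realType) (X : topologicalType) K
  (g : K -> X -> R) l :
  (forall k, continuous (g k)) -> continuous (abs_sum g l).
Proof.
move=> gc; apply: continuous_big => [|k _ x].
  exact: pseudometric_normed_Zmodule.add_continuous.
by apply: cvg_norm; exact: gc.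
Qed.

(** In terms of the Stone-Cech compactification: every nonempty intersection of
    zero sets of the compactification, indexed by [K], meets [X]. *)
Definition common_zero_property (R : realType) (K : Type)
    (X : topologicalType) : Prop :=
  forall g : K -> X -> R, (forall k, continuous (g k)) ->
    (forall l, exists x, abs_sum g l x < 1) -> exists x, forall k, g k x = 0.

Lemma common_zero_property_inj (R : realType) (K L : Type) (X : topologicalType)
    (e : L -> K) : injective e ->
  common_zero_property R K X -> common_zero_property R L X.
Proof.
move=> einj XK g gc gap.
(* The family is extended by zero outside the range of e. *)
have /choice[d eK] k : exists o : option L,
    forall i, e i = k -> o = Some i.
  have [[i <-]|] := pselect (exists i, e i = k).
    by exists (Some i) => j /einj->.
  by move=> nk; exists None => i ei; exfalso; apply: nk; exists i.
have ed i : d (e i) = Some i by exact: eK.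
pose h k := if d k is Some i then g i else cst 0.
have [k||x hx] := XK h.
- by rewrite /h; case: (d k) => [i|]; [exact: gc|move=> x; exact: cvg_cst].
- move=> l; have [x gx] := gap (pmap d l); exists x.
  move: gx; rewrite [in X in X -> _]/abs_sum big_pmap /abs_sum; congr (is_true (_ < _)).
  by apply: eq_bigr => k _; rewrite /h; case: (d k) => //=; rewrite normr0.
- by exists x => i; have := hx (e i); rewrite /h ed.
Qed.

(** If [h] is unbounded, the constant family with value [1 / (1 + |h|)] is
    approximately vanishing, yet has no zero. *)
Lemma common_zero_property_bounded (R : realType) (K : Type)
    (X : topologicalType) (k0 : K) (h : X -> R) :
  common_zero_property R K X -> continuous h ->
  exists n : nat, forall x, `|h x| <= n%:R.
Proof.
move=> XK hc; apply: contrapT => unb.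
have [_||x /(_ k0)/eqP] := XK (fun _ x => (1 + `|h x|)^-1).
- move=> x; apply: cvgV; first by rewrite gt_eqF// ltr_wpDr.
  by apply: cvgD; [exact: cvg_cst|apply: cvg_norm; exact: hc].
- move=> l; have /existsNP[x /negP] : ~ forall x, `|h x| <= (size l)%:R.
    by move=> hl; apply: unb; exists (size l).
  rewrite -ltNge => lx; exists x; rewrite /abs_sum big_const_seq count_predT.
  have h1 : 0 < 1 + `|h x| by rewrite ltr_wpDr.
  rewrite iter_addr_0 ger0_norm ?invr_ge0 ?ltW// -mulr_natl ltr_pdivrMr// mul1r.
  by rewrite (lt_le_trans lx)// lerDr.
- by rewrite invr_eq0 gt_eqF// ltr_wpDr.
Qed.

Section PointwiseTopology.
Context {R : realType} {K : Type}.

Lemma eval_continuous k (q : {ptws K -> R}) :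
  (fun p : {ptws K -> R} => p k) @ q --> q k.
Proof. exact: (@proj_continuous {classic K} (fun=> R) k). Qed.

Lemma cvg_ptws (F : set_system {ptws K -> R}) (p : {ptws K -> R}) :
  Filter F -> (forall k, (fun q : {ptws K -> R} => q k) @ F --> p k) -> F --> p.
Proof.
move=> FF Fp; apply/cvg_sup => k A [_ [[B oB <-] Bp] BA].
apply: filterS BA _; apply: (Fp k); exact: open_nbhs_nbhs.
Qed.

Lemma continuous_ptws (X : topologicalType) (f : X -> {ptws K -> R}) :
  (forall k, continuous (fun x => f x k)) -> continuous f.
Proof. by move=> fc x; apply: cvg_ptws => k; exact: fc. Qed.

Lemma continuous_coordinate (X : topologicalType) (f : X -> {ptws K -> R}) k :
  continuous f -> continuous (fun x => f x k).
Proof.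
by move=> fc x; exact: (cvg_comp _ _ (fc x) (@eval_continuous k (f x))).
Qed.

Lemma near_coordinates (p : {ptws K -> R}) l :
  nbhs p [set q | abs_sum (fun k (q : {ptws K -> R}) => q k - p k) l q < 1].
Proof.
have Dc k : continuous (fun q : {ptws K -> R} => q k - p k).
  by move=> q; exact: (cvgB (@eval_continuous k q) (cvg_cst (p k))).
have := @continuous_abs_sum R {ptws K -> R} K _ l Dc p.
move/(cvgr_lt (abs_sum _ l p))/(_ 1); apply.
by rewrite /abs_sum big1 ?ltr01// => k _; rewrite subrr normr0.
Qed.

(** The sets in question form a filter base converging to [p], which spares the
    description of the subbase of the product topology. *)
Lemma nbhs_coordinates (p : {ptws K -> R}) (A : set {ptws K -> R}) :
  nbhs p A -> exists l, forall q : {ptws K -> R},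
    abs_sum (fun k (q : {ptws K -> R}) => q k - p k) l q < 1 -> A q.
Proof.
pose D k (q : {ptws K -> R}) := q k - p k.
pose F := filter_from [set: seq K] (fun l => [set q | abs_sum D l q < 1]).
have FF : Filter F.
  apply: filter_from_filter; first by exists [::].
  move=> l1 l2 _ _; exists (l1 ++ l2) => // q ql.
  have : abs_sum D (l1 ++ l2) q < 1 by [].
  rewrite abs_sum_cat => l12; split => //=;
    by rewrite (le_lt_trans _ l12)// ?lerDl ?lerDr abs_sum_ge0.
suff Fp : F --> p by move=> /Fp[l _ lA]; exists l.
apply: cvg_ptws => k; apply/cvgrPdist_lt => e e0.
exists (nseq (Num.bound e^-1) k) => // q /= ql.
have : abs_sum D (nseq (Num.bound e^-1) k) q < 1 by [].
rewrite abs_sum_nseq distrC -mulr_natr => pq.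
have eb : 1 < e * (Num.bound e^-1)%:R.
  by rewrite -ltr_pdivrMl// mulr1 archi_boundP// invr_ge0 ltW.
rewrite ltNge; apply/negP => eD.
have := lt_trans pq eb; rewrite ltNge => /negP; apply.
by rewrite ler_wpM2r.
Qed.

End PointwiseTopology.

(** For the direct implication, a cluster point in the compact image of the filter
    generated by the approximate zeros must be the zero of [R^K]. For the converse,
    the image is bounded in each coordinate, hence lies in a compact box, and is
    closed because a point [p] of its closure makes the family [f - p]
    approximately vanishing. *)
Lemma kappa_pseudocompactP (R : realType) (K : Type) (X : topologicalType) :
  inhabited K -> kappa_pseudocompact R K X <-> common_zero_property R K X.
Proof.
move=> [k0]; split=> [Xpc g gc gap|XK f fc].
  pose f x : {ptws K -> R} := fun k => g k x.
  have fco : continuous f by exact: continuous_ptws.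
  pose U l := [set f x | x in [set x | abs_sum g l x < 1]].
  have FU : ProperFilter (filter_from setT U).
    apply: filter_from_proper; last first.
      by move=> l _; have [x] := gap l; exists (f x), x.
    apply: filter_from_filter; first by exists [::].
    move=> l1 l2 _ _; exists (l1 ++ l2) => // _ [x xl <-].
    have : abs_sum g (l1 ++ l2) x < 1 by [].
    rewrite abs_sum_cat => l12; split; exists x => //=;
      by rewrite (le_lt_trans _ l12)// ?lerDl ?lerDr abs_sum_ge0.
  have [|_ [[x _ <-] clx]] := Xpc f fco (filter_from setT U) FU.
    by exists [::] => // _ [x _ <-]; exists x.
  exists x => k; apply/eqP; apply: contrapT => /negP gk0.
  have [n gn] := abs_sum_nseq_ge1 gk0.
  have [] := clx (U (nseq n.*2 k)) [set q : {ptws K -> R} | `|g k x| / 2 < `|q k|].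
  - by exists (nseq n.*2 k).
  - apply: (cvgr_norm_gt _ (@eval_continuous R K k (f x))).
    by rewrite ltr_pdivrMr// ltr_pMr ?normr_gt0// ltr1n.
  - move=> _ [[y /= + <-] /= xy]; rewrite abs_sum_nseq => yl.
    rewrite abs_sum_nseq in gn; have := ler_wMn2r n (ltW xy).
    by rewrite -mulrnAl; move: yl; rewrite -muln2 mulrnA; lra.
have /choice[M fM] k : exists n : nat, forall x, `|f x k| <= n%:R.
  exact: (common_zero_property_bounded k0 XK (continuous_coordinate fc)).
pose box := [set p : {ptws K -> R} | forall k, `[- (M k)%:R, (M k)%:R]%classic (p k)].
apply: (@subclosed_compact _ _ box).
- move=> p clp.
  have [|l|x px] := XK (fun k x => f x k - p k).
  + move=> k x; apply: cvgB; last exact: cvg_cst.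
    exact: continuous_coordinate.
  + have [] := clp _ (near_coordinates p l).
    by move=> _ [[x _ <-] /= fl]; exists x.
  + exists x => //; apply/funext => k; apply/eqP; rewrite -subr_eq0.
    by apply/eqP; exact: px.
- apply: (@tychonoff {classic K} (fun=> R)
    (fun k => `[- (M k)%:R, (M k)%:R]%classic)) => k.
  exact: segment_compact.
- move=> _ [x _ <-] k /=; rewrite in_itv /= -ler_norml; exact: fM.
Qed.

(** * Countable families *)

Section TwicePositivePart.
Context {R : realType}.
Implicit Type a : R.

(** This is [max(0, 2 a)], in a form whose continuity is immediate. *)
Definition twice_pos a : R := a + `|a|.

Lemma twice_pos_ge0 a : 0 <= twice_pos a.
Proof. by rewrite /twice_pos; have := ler_norm (- a); rewrite normrN; lra. Qed.

Lemma twice_pos_ge a : 2 * a <= twice_pos a.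
Proof. by rewrite /twice_pos; have := ler_norm a; lra. Qed.

Lemma twice_pos_eq0 a : (twice_pos a == 0) = (a <= 0).
Proof.
rewrite /twice_pos; case: (lerP a 0) => [/ler0_norm->|a0].
  by rewrite subrr eqxx.
by rewrite (ger0_norm (ltW a0)) gt_eqF// addr_gt0.
Qed.

Lemma twice_pos_continuous (X : topologicalType) (h : X -> R) :
  continuous h -> continuous (twice_pos \o h).
Proof. by move=> hc x; apply: cvgD; [exact: hc|apply: cvg_norm; exact: hc]. Qed.

End TwicePositivePart.

(** If a sequence of functions without common zeros is approximately vanishing, the
    sets [T n < 1] decrease to the empty set in a locally finite way, where [T n] is
    [n] times the sum of the first [n] absolute values. Bump functions on these
    sets, with coefficients growing fast enough, add up to a continuous function
    that exceeds at [y n] the bound for [A n], so that it belongs to no [A n]. *)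
Lemma sigma_bounded_common_zero (R : realType) (X : topologicalType)
    (A : nat -> set (X -> R)) :
  (forall f : X -> R, continuous f -> exists n, A n f) ->
  (forall n x, exists M, forall f, A n f -> `|f x| <= M) ->
  common_zero_property R nat X.
Proof.
move=> Acov Abd g gc gap; apply: contrapT => noz.
have /choice[M AM] n : exists Mn : X -> R, forall x f, A n f -> `|f x| <= Mn x.
  by have [Mn ?] := choice (Abd n); exists Mn.
pose l n := flatten [seq iota 0 n | _ <- iota 0 n].
pose T n := abs_sum g (l n).
have TE n x : T n x = abs_sum g (iota 0 n) x *+ n.
  by rewrite /T abs_sum_flatten big_const_seq count_predT size_iota iter_addr_0.
have Tc n : continuous (T n) by exact: continuous_abs_sum.
have Tle m n x : (m <= n)%N -> T m x <= T n x.
  move=> mn; rewrite !TE; apply: (@le_trans _ _ (abs_sum g (iota 0 n) x *+ m)).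
    by apply: ler_wMn2r; rewrite -(subnKC mn) iotaD abs_sum_cat lerDl abs_sum_ge0.
  by apply: ler_wpMn2l => //; exact: abs_sum_ge0.
have /choice[N TN] x : exists n, 1 < T n x.
  have /existsNP[k /eqP gkx] : ~ forall k, g k x = 0.
    by move=> gx; apply: noz; exists x.
  have gk : 0 < `|g k x| by rewrite normr_gt0.
  set b := Num.bound `|g k x|^-1.
  have gb : 1 < `|g k x| *+ b.
    rewrite -mulr_natr -ltr_pdivrMl// mulr1.
    by apply: archi_boundP; rewrite invr_ge0 ltW.
  exists (k.+1 + b)%N; rewrite TE (lt_le_trans gb)//.
  apply: (@le_trans _ _ (`|g k x| *+ (k.+1 + b))).
    by apply: ler_wpMn2l; rewrite ?leq_addl.
  apply: ler_wMn2r; rewrite iotaD abs_sum_cat -addn1 iotaD abs_sum_cat add0n.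
  rewrite [X in _ + X + _]/abs_sum big_seq1.
  by have := abs_sum_ge0 g (iota 0 k) x; have := abs_sum_ge0 g (iota (k + 1) b) x; lra.
(* Doubling T n makes the bump function at least 1 at y n. *)
have /choice[y yT] n : exists x, T n x + T n x < 1.
  by have [x] := gap (l n ++ l n); rewrite abs_sum_cat; exists x.
pose F n x := `|M n (y n)| * twice_pos (1 - T n x).
have Fc n : continuous (F n).
  move=> x; apply: cvgM; first exact: cvg_cst.
  apply: (@twice_pos_continuous _ _ (fun x => 1 - T n x)) => z.
  by apply: cvgB; [exact: cvg_cst|exact: Tc].
have F0 n x : 0 <= F n x by rewrite mulr_ge0// twice_pos_ge0.
(* Near x only the terms with index below N x are nonzero. *)
pose f x := 1 + \sum_(0 <= n < N x) F n x.
have sumF m n x : (m <= n)%N -> 1 < T m x ->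
    \sum_(0 <= i < n) F i x = \sum_(0 <= i < m) F i x.
  move=> mn Tm; rewrite (big_cat_nat (leq0n m) mn)//= [X in _ + X]big_nat_cond.
  rewrite [X in _ + X]big1 ?addr0// => i /andP[/andP[mi _] _].
  apply/eqP; rewrite mulf_eq0 twice_pos_eq0 subr_le0 orbC.
  by rewrite (le_trans (ltW Tm))// Tle.
have fE m x : 1 < T m x -> f x = 1 + \sum_(0 <= n < m) F n x.
  move=> Tm; rewrite /f -(sumF _ (maxn m (N x))) ?leq_maxr//.
  by rewrite (sumF m)// leq_maxl.
have fc : continuous f.
  move=> x; apply: (@cvg_trans _ ((fun z => 1 + \sum_(0 <= n < N x) F n z) @ x)).
    apply: near_eq_cvg; apply: filterS (cvgr_gt _ (Tc (N x) x) 1 (TN x)).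
    by move=> z /fE ->.
  rewrite (fE _ _ (TN x)).
  apply: cvgD; first exact: cvg_cst.
  apply: continuous_big => [|i _]; last exact: Fc.
  exact: pseudometric_normed_Zmodule.add_continuous.
have [n Anf] := Acov f fc.
have nN : (n < N (y n))%N.
  rewrite ltnNge; apply/negP => /(Tle _ _ (y n)); have := TN (y n); have := yT n.
  by have := abs_sum_ge0 g (l n) (y n); rewrite -/(T n _); lra.
have := AM n (y n) f Anf; apply/negP; rewrite -ltNge.
have fy : 1 + F n (y n) <= f (y n).
  rewrite lerD2l (big_cat_nat (leq0n n) (ltnW nN))/=.
  rewrite [X in _ + X]big_ltn//= [X in _ <= _ + X]addrC addrA lerDr addr_ge0//;
    by apply: sumr_ge0.
rewrite (lt_le_trans _ (ler_norm _))// (lt_le_trans _ fy)//.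
have : `|M n (y n)| <= F n (y n).
  rewrite ler_peMr//; apply: le_trans (twice_pos_ge _).
  by have := yT n; lra.
by have := ler_norm (M n (y n)); lra.
Qed.

(** * Finite supports of uniformly continuous maps *)

Section Supports.
Context {R : realType} {X Y : topologicalType}.
Variable phi : Cp R X -> Cp R Y.

(** The estimate is also required with [m = 0], and its constant depends on [s] only
    through its size, so that a common bound on the sizes of the supports gives the
    same estimate at all points. *)
Definition supports (y : Y) (s : seq X) :=
  forall (f g : Cp R X) (m : nat),
    (forall x, x \in s -> `|(f : X -> R) x - (g : X -> R) x| <= m%:R) ->
    `|(phi f : Y -> R) y - (phi g : Y -> R) y| <= ((size s).+1 * m.+1)%:R.

Lemma nbhs0_Cp (V : set (Cp R X)) : open_nbhs (0 : Cp R X) V ->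
  exists s : seq X, forall u : Cp R X,
    abs_sum (fun x (u : Cp R X) => (u : X -> R) x) s u < 1 -> V u.
Proof.
move=> [[B oB <-] B0].
have /nbhs_coordinates[s sB] : nbhs (Cp_val (0 : Cp R X)) B.
  exact: open_nbhs_nbhs.
exists s => u us; apply: sB; move: us; rewrite /abs_sum.
by under [X in _ -> X < _]eq_bigr do rewrite subr0.
Qed.

Lemma open_nbhs0_eval (y : Y) :
  open_nbhs (0 : Cp R Y) [set u : Cp R Y | `|(u : Y -> R) y| < 1].
Proof.
split; last by rewrite /= normr0.
exists [set q : {ptws Y -> R} | `|q y| < 1] => //.
rewrite openE => q /= qy.
exact: (cvgr_lt _ (cvg_norm (@eval_continuous R Y y q)) 1 qy).
Qed.

(** Uniform continuity gives [s] such that a perturbation of total size [< 1] on [s]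
    moves the value at [y] by less than 1; the segment from [f] to [g] is cut into
    [p] perturbations of this kind. *)
Lemma exists_support (y : Y) :
  Cp_unif_continuous phi -> exists s, supports y s.
Proof.
move=> /(_ _ (open_nbhs0_eval y))[V /nbhs0_Cp[s sV] Vphi].
exists s => f g m fg; set p := ((size s).+1 * m.+1)%N.
have p0 : 0 < p%:R :> R by rewrite ltr0n muln_gt0.
pose w j x : R := (f : X -> R) x + j%:R / p%:R * ((g : X -> R) x - (f : X -> R) x).
have wc j : continuous (w j).
  move=> x; apply: cvgD; first exact: cts_fun.
  by apply: cvgM; [exact: cvg_cst|apply: cvgB; exact: cts_fun].
pose h j : Cp R X := mkcts (wc j).
have h0 : h 0%N = f.
  by apply/continuousEP => x; change (w 0%N x = (f : X -> R) x);
    rewrite /w mul0r mul0r addr0.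
have hp : h p = g.
  by apply/continuousEP => x; change (w p x = (g : X -> R) x);
    rewrite /w divff ?gt_eqF// mul1r addrC subrK.
have step j : `|(phi (h j) : Y -> R) y - (phi (h j.+1) : Y -> R) y| < 1.
  apply: Vphi; apply: sV.
  have hj x : ((h j - h j.+1 : Cp R X) : X -> R) x =
      ((f : X -> R) x - (g : X -> R) x) / p%:R.
    change (w j x - w j.+1 x = ((f : X -> R) x - (g : X -> R) x) / p%:R).
    by rewrite /w -[j.+1]addn1 natrD; lra.
  apply: (@le_lt_trans _ _ (\sum_(x <- s) m%:R / p%:R)).
    rewrite /abs_sum big_seq [leRHS]big_seq; apply: ler_sum => x xs.
    rewrite hj normrM normfV (gtr0_norm p0) ler_pM2r ?invr_gt0//; exact: fg.
  rewrite big_const_seq count_predT iter_addr_0 -mulrnAl -mulrnA.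
  rewrite ltr_pdivrMr// mul1r ltr_nat /p mulnC.
  by rewrite (leq_ltn_trans (leq_mul (leqnSn _) (leqnn m)))// ltn_pmul2l.
rewrite -[in X in X <= _]h0 -{1}hp; elim: (p) => [|j IHj].
  by rewrite subrr normr0.
rewrite -natr1; apply: le_trans (ler_distD ((phi (h j) : Y -> R) y) _ _) _.
by rewrite lerD// ltW.
Qed.

End Supports.

(** * Transfer of the common zero property *)

Section Transfer.
Context {R : realType} {X Y : topologicalType} {K : Type}.
Variables (phi : Cp R X -> Cp R Y) (psi : Cp R Y -> Cp R X).
Hypothesis psiK : cancel psi phi.
Hypothesis phi_uc : Cp_unif_continuous phi.
Hypothesis psi_uc : Cp_unif_continuous psi.

(** The functions bounded by [n] have pointwise bounded images under [phi], and these
    images cover [C(Y)] as [phi] is onto. *)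
Lemma bounded_common_zero_nat :
  (forall h : X -> R, continuous h -> exists n : nat, forall x, `|h x| <= n%:R) ->
  common_zero_property R nat Y.
Proof.
move=> Xbd.
pose A n : set (Y -> R) := [set f | exists2 u : Cp R X,
  (forall x, `|(u : X -> R) x| <= n%:R) & f = (phi u : Y -> R)].
apply: (@sigma_bounded_common_zero _ _ A) => [f fc|n y].
  have [n un] := Xbd (psi (mkcts fc)) (@cts_fun _ _ _).
  by exists n, (psi (mkcts fc)) => //; rewrite psiK.
have [s sy] := exists_support y phi_uc.
exists (((size s).+1 * n.+1)%:R + `|(phi 0 : Y -> R) y|) => _ [u un ->].
have := sy u 0 n; rewrite -lerBlDr => phiu.
apply: le_trans (lerB_dist _ _) _; apply: phiu => x _.
by rewrite subr0.
Qed.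

(** The values at [y] of functions in the image of [phi] differ by more than 1. *)
Lemma support_nonempty y s : supports phi y s -> s != [::].
Proof.
move=> sy; apply/eqP => s0.
have twoc : continuous (fun _ : Y => 2 : R) by move=> z; exact: cvg_cst.
have := sy (psi (mkcts twoc)) (psi 0) 0%N; rewrite s0 !psiK => /(_ _)/wrap[//|].
change (~ (`|(2 : R) - 0| <= 1)).
by rewrite subr0 normr_nat; lra.
Qed.

Section Family.
Variables (g : K -> Y -> R) (gc : forall k, continuous (g k)).
Hypothesis gap : forall l, exists y, abs_sum g l y < 1.
Hypothesis Ynat : common_zero_property R nat Y.

(** Otherwise each [n] has an [l n] such that no point with a support of size [n]
    satisfies [abs_sum g (l n) y < 1]; a common zero of the countably many sums
    [abs_sum g (l n)] would have no finite support. *)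
Lemma supports_of_bounded_size : exists n, forall l,
  exists2 y, abs_sum g l y < 1 & exists2 s, size s = n & supports phi y s.
Proof.
apply: contrapT => /forallNP noN.
have /choice[l lP] n : exists l, forall y s, abs_sum g l y < 1 -> size s = n ->
    ~ supports phi y s.
  have /existsNP[l lP] := noN n; exists l => y s yl sn sy; apply: lP.
  by exists y => //; exists s.
have [n||y yP] := Ynat (g := fun n => abs_sum g (l n)).
- exact: continuous_abs_sum.
- move=> r; have [y] := gap (flatten (map l r)).
  rewrite abs_sum_flatten => yr; exists y; move: yr; rewrite [in X in _ -> X]/abs_sum.
  by under [X in _ -> X < _]eq_bigr do rewrite ger0_norm ?abs_sum_ge0//.
have [s sy] := exists_support y phi_uc.
by apply: (lP (size s) y s) sy => //; rewrite yP.
Qed.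

Lemma bump l (M : nat) : exists h : Cp R Y,
  (forall y, 1 <= abs_sum g l y -> (h : Y -> R) y = 0) /\
  (forall y, abs_sum g (l ++ l) y < 1 -> M%:R <= (h : Y -> R) y).
Proof.
have hc : continuous (fun y => M%:R * twice_pos (1 - abs_sum g l y)).
  move=> y; apply: cvgM; first exact: cvg_cst.
  apply: (@twice_pos_continuous _ _ (fun y => 1 - abs_sum g l y)) => z.
  by apply: cvgB; [exact: cvg_cst|exact: continuous_abs_sum].
exists (mkcts hc : Cp R Y); split=> y.
  move=> y1; change (M%:R * twice_pos (1 - abs_sum g l y) = 0).
  by apply/eqP; rewrite mulf_eq0 twice_pos_eq0 subr_le0 y1 orbT.
rewrite abs_sum_cat => yl.
change (M%:R <= M%:R * twice_pos (1 - abs_sum g l y)).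
by rewrite ler_peMr// (le_trans _ (twice_pos_ge _))//; lra.
Qed.

(** The pair [(V, p)] stands for a point of the Stone-Cech compactification of [X],
    the limit of [p] along [V]; no compactification is formed, because along an
    ultrafilter an inequality either holds eventually or fails eventually. If no
    coordinate [p i] of the supports worked, then for each [i] the values of
    [psi h] would be bounded along [V] for all [h] vanishing off one set; the bump
    on the intersection of these sets contradicts this. *)
Lemma exists_essential_point : exists (V : set_system Y) (p : Y -> X),
  ProperFilter V /\ forall l (N : nat), exists h : Cp R Y,
    (forall y, 1 <= abs_sum g l y -> (h : Y -> R) y = 0) /\
    V [set y | N%:R <= `|(psi h : X -> R) (p y) - (psi 0 : X -> R) (p y)|].
Proof.
have [n nP] := supports_of_bounded_size.
have [y0 _ [s0 _ /support_nonempty]] := nP [::].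
case: s0 => // x0 _ _.
have /choice[S SP] y : exists s, (exists2 s, size s = n & supports phi y s) ->
    size s = n /\ supports phi y s.
  have [[s]|no] := pselect (exists2 s, size s = n & supports phi y s).
    by exists s.
  by exists [::].
pose supp_n := [set y | size (S y) = n /\ supports phi y (S y)].
have VF : ProperFilter
    (filter_from setT (fun l => [set y | abs_sum g l y < 1] `&` supp_n)).
  apply: filter_from_proper => [|l _]; last first.
    by have [y yl ys] := nP l; exists y; split=> //; exact: SP.
  apply: filter_from_filter; first by exists [::].
  move=> l1 l2 _ _; exists (l1 ++ l2) => // y [yl yn].
  have : abs_sum g (l1 ++ l2) y < 1 by [].
  rewrite abs_sum_cat => l12.
  by split; split=> //=; rewrite (le_lt_trans _ l12)// ?lerDl ?lerDr abs_sum_ge0.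
have [V [VU sV]] := ultraFilterLemma VF.
have VP : ProperFilter V by exact: ultra_proper.
apply: contrapT => /forallNP/(_ V)/forallNP noP.
pose p i y := nth x0 (S y) i.
have /choice[lN lNP] i : exists lN : seq K * nat, forall h : Cp R Y,
    (forall y, 1 <= abs_sum g lN.1 y -> (h : Y -> R) y = 0) ->
    V [set y | `|(psi h : X -> R) (p i y) - (psi 0 : X -> R) (p i y)| <= lN.2%:R].
  have := noP (p i) => /not_andP[//|/existsNP[l /existsNP[N noh]]].
  exists (l, N) => h hl.
  have [Vh|] := in_ultra_setVsetC [set y |
      N%:R <= `|(psi h : X -> R) (p i y) - (psi 0 : X -> R) (p i y)|] VU.
    by exfalso; apply: noh; exists h.
  by apply: filterS => y /negP; rewrite -ltNge => /ltW.
pose l := flatten [seq (lN i).1 | i <- iota 0 n].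
pose N := (\sum_(i < n) (lN i).2)%N.
have [h [h0 hM]] := bump l (n.+1 * N.+1).+1.
have Vh : V [set y | forall i : 'I_n,
    `|(psi h : X -> R) (p i y) - (psi 0 : X -> R) (p i y)| <= N%:R].
  apply: filter_forall => i; have := lNP i h.
  have hl y : 1 <= abs_sum g (lN i).1 y -> (h : Y -> R) y = 0.
    move=> yl; apply: h0; apply: le_trans yl _.
    by apply: (abs_sum_flatten_ge g (fun i => (lN i).1)); rewrite mem_iota /=.
  move=> /(_ hl); apply: filterS => y /le_trans; apply.
  by rewrite ler_nat /N (bigD1 i)//= leq_addr.
have Vl : V ([set y | abs_sum g (l ++ l) y < 1] `&` supp_n).
  by apply: sV; exists (l ++ l).
have [y [/= yh [/hM yM [Sn Sy]]]] := filter_ex (filterI Vh Vl).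
have := Sy (psi h) (psi 0) N; rewrite !psiK subr0.
move=> /(_ _)/wrap[x|].
  move=> /(nthP x0)[i]; rewrite Sn => iN <-; exact: (yh (Ordinal iN)).
rewrite Sn => hN; have := le_trans yM (le_trans (ler_norm _) hN).
by rewrite ler_nat ltnn.
Qed.

End Family.

(** The zeros of [F lN] are the points where [psi (h lN)] and [psi 0] differ by at
    least [lN.2]. At a common zero [x] the differences are unbounded for each [l],
    hence [h (l, N)] cannot vanish on a support of [x], which thus meets the set
    [abs_sum g l < 1]. *)
Lemma common_zero_property_transfer (k0 : K) (e : seq K * nat -> K) :
  injective e -> common_zero_property R K X -> common_zero_property R K Y.
Proof.
move=> einj XK g gc gap.
have Xbd (h : X -> R) : continuous h -> exists n : nat, forall x : X, `|h x| <= n%:R.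
  exact: (common_zero_property_bounded k0 XK).
have [V [p [VP Vp]]] :=
  exists_essential_point gc gap (bounded_common_zero_nat Xbd).
have /choice[h hP] (lN : seq K * nat) := Vp lN.1 lN.2.
pose F lN x := twice_pos (lN.2%:R -
  `|(psi (h lN) : X -> R) x - (psi 0 : X -> R) x|).
have [lN|r|x Fx] := common_zero_property_inj einj XK (g := F).
- apply: (@twice_pos_continuous _ _ (fun x => lN.2%:R -
    `|(psi (h lN) : X -> R) x - (psi 0 : X -> R) x|)) => x.
  apply: cvgB; first exact: cvg_cst.
  by apply: cvg_norm; apply: cvgB; exact: cts_fun.
- have : V [set y | abs_sum F r (p y) = 0].
    elim: r => [|lN r IHr].
      by apply: filterS filterT => y _ /=; rewrite /abs_sum big_nil.
    apply: filterS2 IHr (hP lN).2 => y /= yr ylN.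
    rewrite /abs_sum big_cons -/(abs_sum F r _) yr addr0.
    by apply/eqP; rewrite normr_eq0 twice_pos_eq0 subr_le0.
  by move=> /filter_ex[y /= yr]; exists (p y); rewrite yr.
have [t tx] := exists_support x psi_uc.
apply: (@common_zero_in_seq _ _ _ g t) => l; apply: contrapT => tl.
pose N := ((size t).+1 * 1).+1.
have : N%:R <= `|(psi (h (l, N)) : X -> R) x - (psi 0 : X -> R) x|.
  by rewrite -subr_le0 -twice_pos_eq0; apply/eqP; exact: (Fx (l, N)).
apply/negP; rewrite -ltNge; apply: (@le_lt_trans _ _ ((size t).+1 * 1)%:R).
  apply: tx => y yt; rewrite subr0 (hP (l, N)).1 ?normr0// leNgt.
  by apply/negP => yl; apply: tl; exists y.
by rewrite ltr_nat.
Qed.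

End Transfer.

Theorem theorem1p1 (R : realType) (X Y : topologicalType) (K : Type)
    (tychX : tychonoff_space X) (tychY : tychonoff_space Y)
    (infK : infinite_set [set: K])
    (uhXY : Cp_uniformly_homeomorphic R X Y) :
  kappa_pseudocompact R K X <-> kappa_pseudocompact R K Y.
Proof.
have [k0 _] := infinite_setN0 infK.
have [e einj] := infinite_seq_nat_embeds infK.
have [phi [psi [phiK psiK _ phi_uc psi_uc]]] := uhXY.
rewrite !(kappa_pseudocompactP _ _ (inhabits k0)); split.
  exact: (common_zero_property_transfer psiK phi_uc psi_uc k0 einj).
exact: (common_zero_property_transfer phiK psi_uc phi_uc k0 einj).
Qed.
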